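(* Let $G$ be a connected graph with at least two vertices and let $\Delta(G)$ be the maximum degree of $G$. Then $$edim(G)\ge \left\lceil \log_2 \Delta(G)\right\rceil.$$
   Context: All graphs are finite and simple. For a connected graph $G=(V,E)$, $d_G(x,y)$ is the length of a shortest path between vertices $x,y$. The distance between a vertex $v$ and an edge $e=uw$ is $d_G(e,v)=\min\{d_G(u,v),d_G(w,v)\}$. A vertex $w$ distinguishes two edges $e_1,e_2$ if $d_G(w,e_1)\ne d_G(w,e_2)$. A set $S\subseteq V$ is an edge metric generator for $G$ if every two distinct edges of $G$ are distinguished by some vertex of $S$; the edge metric dimension $edim(G)$ is the smallest cardinality of an edge metric generator for $G$. *)

(* Defs.v *)
From mathcomp Require Import all_boot.

Set Implicit Arguments.
Unset Strict Implicit.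
Unset Printing Implicit Defensive.

Record sgraph := SGraph {
  vertex :> finType;
  adj : rel vertex;
  adj_sym : symmetric adj;
  adj_irrefl : irreflexive adj }.

Definition graph_connected (G : sgraph) : Prop :=
  forall x y : G, connect (@adj G) x y.

Definition degree (G : sgraph) (v : G) : nat := #|[set w | adj v w]|.

Definition max_degree (G : sgraph) : nat := \max_(v : G) degree v.

Definition edges (G : sgraph) : {set {set G}} :=
  [set [set p.1; p.2] | p : G * G & adj p.1 p.2].

Definition has_gpath (G : sgraph) (x y : G) (n : nat) : bool :=
  [exists p : n.-tuple G,
    [&& path (@adj G) x p, uniq (x :: p) & last x p == y]].

(* Paths do not repeat vertices, so their lengths are below #|G|; the value   *)
(* #|G| is only taken when x and y are not joined by any path (gdistP).       *)
Definition gdist (G : sgraph) (x y : G) : nat :=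
  \big[minn/#|G|]_(n < #|G| | has_gpath x y n) n.

(* The default #|G| is irrelevant on edges (edge_distE).                      *)
Definition edge_dist (G : sgraph) (e : {set G}) (v : G) : nat :=
  \big[minn/#|G|]_(u in e) gdist u v.

Definition distinguishes (G : sgraph) (w : G) (e1 e2 : {set G}) : bool :=
  edge_dist e1 w != edge_dist e2 w.

Definition edge_metric_generator (G : sgraph) (S : {set G}) : bool :=
  [forall e1 in edges G, forall e2 in edges G,
    (e1 != e2) ==> [exists w in S, distinguishes w e1 e2]].

(* The whole vertex set is always an edge metric generator                    *)
(* (edge_metric_generatorT), so this is a genuine minimum (edimP).            *)
Definition edim (G : sgraph) : nat :=
  #|[arg min_(S < [set: G] | edge_metric_generator S) #|S|]|.

Lemma bigminn_le (I : finType) (P : pred I) (F : I -> nat) k i :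
  P i -> \big[minn/k]_(j | P j) F j <= F i.
Proof.
move=> Pi; have : i \in index_enum I by rewrite mem_index_enum.
elim: (index_enum I) => // j r IHr; rewrite inE big_cons.
case/predU1P=> [<-|/IHr]; first by rewrite Pi geq_minl.
by case: ifP => // _ le_r; rewrite geq_min le_r orbT.
Qed.

Lemma bigminn_mem (I : finType) (P : pred I) (F : I -> nat) k :
  \big[minn/k]_(j | P j) F j = k \/
  (exists2 i, P i & \big[minn/k]_(j | P j) F j = F i).
Proof.
elim/big_ind: _ => [|a b ha hb|i Pi]; first by left.
  by rewrite /minn; case: ifP.
by right; exists i.
Qed.

Section Facts.
Variable G : sgraph.
Implicit Types (x y u v w : G) (e : {set G}) (S : {set G}).

Lemma gdist_le x y : gdist x y <= #|G|.
Proof.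
rewrite /gdist; elim/big_ind: _ => // [m n hm _|n _]; last exact: ltnW.
by rewrite geq_min hm.
Qed.

Lemma has_gpath_lt x y n : has_gpath x y n -> n < #|G|.
Proof.
case/existsP=> p /and3P[_ Up _].
by have := max_card (mem (x :: p)); rewrite (card_uniqP Up) /= size_tuple.
Qed.

Lemma connect_gpath x y :
  connect (@adj G) x y -> exists n, has_gpath x y n.
Proof.
case/connectP=> p hp ->; case/shortenP: hp => q Pq Uq _.
by exists (size q); apply/existsP; exists (in_tuple q); rewrite Pq Uq eqxx.
Qed.

Lemma gdistP x y :
  if connect (@adj G) x y
  then has_gpath x y (gdist x y) /\
       (forall n, has_gpath x y n -> gdist x y <= n)
  else gdist x y = #|G|.
Proof.
case: ifP => [/connect_gpath[m hm]|nxy]; last first.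
  rewrite /gdist big_pred0 // => n; apply/existsP=> -[p /and3P[Pp _ /eqP yE]].
  by move/connectP: nxy; apply; exists p.
have lb n : has_gpath x y n -> gdist x y <= n.
  move=> hn; exact: (bigminn_le (fun i : 'I_#|G| => i : nat) #|G|
    (hn : has_gpath x y (Ordinal (has_gpath_lt hn)))).
split=> //; rewrite /gdist.
case: (bigminn_mem (fun n : 'I_#|G| => has_gpath x y n)
        (fun n : 'I_#|G| => n : nat) #|G|) => [E|[i hi ->] //].
by have := leq_ltn_trans (lb _ hm) (has_gpath_lt hm); rewrite /gdist E ltnn.
Qed.

Lemma gdist_eq0 x y : (gdist x y == 0) = (x == y).
Proof.
have G0 : 0 < #|G| by apply/card_gt0P; exists x.
apply/eqP/eqP=> [E|<-]; last first.
  have := gdistP x x; rewrite connect0 => -[_ le]; apply/eqP.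
  rewrite -leqn0 le //; apply/existsP; exists [tuple].
  by rewrite /= eqxx.
have := gdistP x y; rewrite E; case: ifP => [_ [/existsP[[[|//] ?]] /= /eqP xy _]|_ G00].
  exact: xy.
by rewrite -G00 in G0.
Qed.

Lemma edge_distE u w v :
  edge_dist [set u; w] v = minn (gdist u v) (gdist w v).
Proof.
rewrite /edge_dist; apply/eqP; rewrite eqn_leq leq_min !bigminn_le ?set21 ?set22 //=.
elim/big_ind: _ => [|a b|i /set2P[]->]; rewrite ?geq_minl ?geq_minr //.
  by rewrite geq_min gdist_le.
by rewrite [_ <= minn a b]leq_min => -> ->.
Qed.

Lemma edge_dist_eq0 e v : (edge_dist e v == 0) = (v \in e).
Proof.
have G0 : 0 < #|G| by apply/card_gt0P; exists v.
apply/idP/idP=> [|ve]; last first.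
  by rewrite -leqn0 -(eqP (etrans (gdist_eq0 v v) (eqxx v))) bigminn_le.
apply: contraTT => ve; rewrite -lt0n /edge_dist.
elim/big_ind: _ => // [a b ha hb|u ue]; first by rewrite leq_min ha.
by rewrite lt0n gdist_eq0; apply: contraNneq ve => <-.
Qed.

Lemma edge_metric_generatorT : edge_metric_generator ([set: G] : {set G}).
Proof.
apply/forall_inP=> e1 _; apply/forall_inP=> e2 _; apply/implyP.
apply: contra_neqT => /exists_inPn nd; apply/setP=> v.
by rewrite -!edge_dist_eq0; have := nd v (in_setT v); rewrite negbK => /eqP->.
Qed.

Lemma edimP :
  (exists2 S : {set G}, edge_metric_generator S & #|S| = edim G) /\
  (forall S : {set G}, edge_metric_generator S -> edim G <= #|S|).
Proof.
rewrite /edim; case: arg_minnP => [|S hS minS].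
  exact: edge_metric_generatorT.
by split; first by exists S.
Qed.

End Facts.

(* Main.v *)
Require Import Defs.
From mathcomp Require Import all_boot all_order all_algebra.
From mathcomp Require Import reals exp.

(** Fix a vertex [v] and an edge metric generator [S]. Seen from any vertex
    [w], every edge at [v] lies at distance [gdist v w] or [gdist v w - 1],
    because the distances to [w] from the two ends of an edge differ by at most
    one ([edge_dist_at]). Each [w] in [S] therefore yields a single bit about
    such an edge, and [S] tells all edges at [v] apart, so there are at most
    [2 ^ #|S|] of them ([degree_le_exp]). With [v] of maximum degree and [S] of
    minimum size this reads [max_degree G <= 2 ^ edim G], of which the theorem
    is the base 2 logarithm. *)

Set Implicit Arguments.
Unset Strict Implicit.
Unset Printing Implicit Defensive.

Import Order.TTheory GRing.Theory Num.Theory.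

Section EdgesAtVertex.
Variable G : sgraph.
Implicit Types (u v w : G) (S : {set G}).

Lemma mem_edges v u : adj v u -> [set v; u] \in edges G.
Proof. by move=> vu; apply/imsetP; exists (v, u); rewrite ?inE. Qed.

(** A walk can be shortened to a path without repeated vertices, so it bounds
    the distance as well. *)
Lemma gdist_le_walk v w p : path (@adj G) v p -> last v p = w ->
  gdist v w <= size p.
Proof.
move=> vp <-; case/shortenP: vp => q vq Uq /uniq_leq_size sub_qp.
have vw : connect (@adj G) v (last v q) by apply/connectP; exists q.
have := gdistP v (last v q); rewrite vw => -[_ le_dist].
apply: leq_trans (sub_qp _); last by case/andP: Uq.
by apply: le_dist; apply/existsP; exists (in_tuple q); rewrite vq Uq eqxx.
Qed.

Lemma gdist_adj v u w : adj v u -> gdist v w <= (gdist u w).+1.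
Proof.
move=> vu; have := gdistP u w; case: ifP => _; last first.
  by move=> ->; apply: leqW; apply: gdist_le.
case=> /existsP[p /and3P[up _ /eqP pw]] _.
rewrite -[in leqRHS](size_tuple p).
by apply: (@gdist_le_walk v w (u :: p)); rewrite /= ?vu.
Qed.

Lemma edge_dist_at v u w : adj v u ->
  edge_dist [set v; u] w =
  gdist v w - (edge_dist [set v; u] w < gdist v w).
Proof.
move=> /(gdist_adj w); rewrite edge_distE /minn.
case: ltnP => [|uw vw]; first by rewrite ltnn subn0.
case: ltngtP uw => // [lt_uw _ | -> _]; last by rewrite subn0.
have /eqP -> : gdist v w == (gdist u w).+1 by rewrite eqn_leq vw lt_uw.
by rewrite /= subn1.
Qed.

Lemma degree_le_exp v S : edge_metric_generator S -> degree v <= 2 ^ #|S|.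
Proof.
move=> genS; rewrite -card_powerset /degree.
(* The bits that the vertices of S give about the edge from v to u, as a set. *)
pose closer u := [set w in S | edge_dist [set v; u] w < gdist v w].
have closer_inj : {in [set u | adj v u] &, injective closer}.
  move=> u1 u2; rewrite !inE => vu1 vu2 eq12; apply/eqP.
  have: [set v; u1] == [set v; u2].
    have := forall_inP (forall_inP genS _ (mem_edges vu1)) _
                      (mem_edges vu2).
    apply: contraTT => ne12; rewrite negb_imply ne12 /=.
    apply/exists_inPn => w wS; rewrite negbK edge_dist_at // eq_sym.
    rewrite edge_dist_at //; apply/eqP.
    by move/setP/(_ w): eq12; rewrite !inE wS /= => ->.
  move/eqP/setP/(_ u1); rewrite set22 !inE => /esym/orP[/eqP u1v|//].
  by rewrite u1v adj_irrefl in vu1.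
rewrite -(card_in_imset closer_inj); apply/subset_leq_card/subsetP => A.
by case/imsetP => u _ ->; rewrite powersetE; apply/subsetP => w /setIdP[].
Qed.

Lemma max_degree_le_exp_edim : max_degree G <= 2 ^ edim G.
Proof.
have [[S genS <-] _] := edimP G.
by apply/bigmax_leqP => v _; apply: degree_le_exp.
Qed.

End EdgesAtVertex.

Lemma ceil_log2_le (R : realType) (m k : nat) : m <= 2 ^ k ->
  (Num.ceil ((ln m%:R / ln 2%:R)%R : R) <= k%:Z)%R.
Proof.
move=> le_m; rewrite ceil_le_int -pmulrn.
have ln2_gt0 : (0 < ln 2%:R :> R)%R by rewrite ln_gt0 ?ltr1n.
rewrite ler_pdivrMr // mulr_natl -lnXn ?ltr0n // -natrX.
case: m le_m => [_|m le_m]; last by rewrite ler_ln ?posrE ?ltr0n ?expn_gt0 ?ler_nat.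
(* The logarithm of 0 is 0 by convention. *)
by rewrite ln0 // ln_ge0 // ler1n expn_gt0.
Qed.

Theorem proposition23 (R : realType) (G : sgraph)
    (G_connected : graph_connected G) (G_order : (2 <= #|G|)%N) :
  (Num.ceil ((ln (max_degree G)%:R / ln 2%:R)%R : R) <= (edim G)%:Z)%R.
Proof. exact/ceil_log2_le/max_degree_le_exp_edim. Qed.
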